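(* Let $\Bbbk$ be a field and let $A=A_\mu(R,\boldsymbol\partial,\mathbf a)$ be a twisted generalized Weyl Poisson algebra (TGWPA) of type $(A_1)^n$, with scalars $\gamma_{ij}$ given by $\partial_j(a_i)=\gamma_{ij}a_i$ for $i\ne j$, and with its standard $\mathbb Z^n$-grading. Let $q_{kj},p_{kj}\in\Bbbk^\times$ for $k,j\in[n]$, and let $\delta=\{\delta_{\boldsymbol\alpha}\mid\boldsymbol\alpha\in\mathbb Z^n\}$ be a Poisson twisting system of $A$ with $\delta_{\boldsymbol\alpha}=\sum_{i=1}^n\alpha_i\delta_{\mathbf e_i}$ such that for all $k,j\in[n]$: (i) $\delta_{\mathbf e_k}(x_j)=q_{kj}x_j$ and $\delta_{\mathbf e_k}(y_j)=p_{kj}y_j$; (ii) $\delta_{\mathbf e_k}(a_j)=(q_{kj}+p_{kj})a_j$; (iii) $\partial_j\delta_{\mathbf e_k}=\delta_{\mathbf e_k}\partial_j$ on $R$. Set $\eta_{ij}=\gamma_{ij}-q_{ji}-p_{ji}$ and $\nu_{ij}=\mu_{ij}-q_{ij}-p_{ji}$ for $i\ne j$, and let $\boldsymbol\nabla=(\nabla_1,\dots,\nabla_n)$ where $\nabla_i=\partial_i-\delta_{\mathbf e_i}$ on $R$ for $i\in[n]$. Then $A^\delta\cong A_\nu(R,\boldsymbol\nabla,\mathbf a)$ as Poisson algebras, where the right-hand side is the TGWPA with parameters $\nu_{ij}$ and with $\eta_{ij}$ in the role of $\gamma_{ij}$.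
   Context: All algebras are over a field $\Bbbk$; $[n]=\{1,\dots,n\}$ and $\mathbf e_i$ are the standard basis vectors of $\mathbb Z^n$. A Poisson algebra is a commutative algebra $R$ with a Lie bracket $\{,\}$ such that each $\{r,-\}$ is a derivation. A derivation $\partial$ of $R$ is a Poisson derivation if $\partial(\{r,s\})=\{\partial(r),s\}+\{r,\partial(s)\}$ for all $r,s$. An element $a$ is Poisson central if $\{a,-\}=0$. TGWPA of type $(A_1)^n$: Fix an integer $n\ge 1$. Let $R$ be a Poisson algebra, $\boldsymbol\partial=(\partial_1,\dots,\partial_n)$ an $n$-tuple of pairwise commuting Poisson derivations of $R$, and $\mathbf a=(a_1,\dots,a_n)$ an $n$-tuple of Poisson central regular (non-zero-divisor) elements of $R$. Assume there are scalars $\mu_{ij},\gamma_{ij}\in\Bbbk$ ($i\ne j$) with $\partial_j(a_i)=\gamma_{ij}a_i$ and $\gamma_{ij}+\gamma_{ji}=\mu_{ij}+\mu_{ji}$ for all $i\neq j$. Then $A_\mu(R,\boldsymbol\partial,\mathbf a)$ is the algebra $R[x_1,y_1,\dots,x_n,y_n]/(y_1x_1-a_1,\dots,y_nx_n-a_n)$ with Poisson bracket extending that of $R$ and given by $\{r,x_i\}=\partial_i(r)x_i$, $\{r,y_i\}=-\partial_i(r)y_i$, $\{y_i,x_i\}=\partial_i(a_i)$ for $i\in[n]$, $r\in R$, and $\{y_i,x_j\}=\mu_{ij}x_jy_i$, $\{x_i,x_j\}=(\gamma_{ij}-\mu_{ij})x_ix_j$, $\{y_i,y_j\}=(\mu_{ji}-\gamma_{ij})y_iy_j$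 for $i\ne j$ in $[n]$. It is a $\mathbb Z^n$-graded Poisson algebra with $\deg x_i=\mathbf e_i$, $\deg y_i=-\mathbf e_i$, $\deg r=\mathbf 0$ for $r\in R$. Poisson twists: let $G$ be an abelian group and $A$ a $G$-graded Poisson algebra. A set $\delta=\{\delta_g\mid g\in G\}$ of graded (degree-preserving) Poisson derivations of $A$ is a Poisson twisting system if $\delta_g\delta_h=\delta_h\delta_g$ for all $g,h\in G$ and $\delta_{|ab|}=\delta_{|a|}+\delta_{|b|}$ for all homogeneous $a,b\in A$, where $|a|=\deg a$. The Poisson twist $A^\delta$ is the algebra $A$ with the new Poisson bracket $\langle a,b\rangle=\{a,b\}+a\delta_{|a|}(b)-b\delta_{|b|}(a)$ for homogeneous $a,b$. *)

(* Defs.v *)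
From HB Require Import structures.
From mathcomp Require Import all_boot all_order all_algebra.
From mathcomp Require Import mpoly.
From mathcomp Require Import boolp classical_sets.

Set Implicit Arguments.
Unset Strict Implicit.
Unset Printing Implicit Defensive.

Import GRing.Theory.
Local Open Scope quotient_scope.
Local Open Scope ring_scope.

Section Poisson.
Variables (K : fieldType) (A : comAlgType K).
Implicit Types (br : A -> A -> A) (d : A -> A).

Definition derivation d : Prop :=
  linear d /\ forall u v, d (u * v) = d u * v + u * d v.

Record poisson_bracket br : Prop := PoissonBracket {
  pbr_linearl : forall v, linear (br^~ v);
  pbr_der : forall u, derivation (br u);
  pbr_alt : forall u, br u u = 0;
  pbr_jacobi : forall u v w,
    br u (br v w) + br v (br w u) + br w (br u v) = 0 }.

Definition poisson_derivation br d : Prop :=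
  derivation d /\ forall u v, d (br u v) = br (d u) v + br u (d v).

Definition poisson_central br (u : A) : Prop := forall v, br u v = 0.

End Poisson.

Definition poisson_isomorphic (K : fieldType) (A B : comAlgType K)
    (brA : A -> A -> A) (brB : B -> B -> B) : Prop :=
  exists f : {lrmorphism A -> B},
    bijective f /\ forall u v, f (brA u v) = brB (f u) (f v).

(* [piece g u] says that u lies in the degree g component of a G-grading of A;
   in particular 0 is homogeneous of every degree. *)
Section Twist.
Variables (K : fieldType) (A : comAlgType K) (br : A -> A -> A).
Variables (G : zmodType) (piece : G -> A -> Prop) (delta : G -> A -> A).

(* The degree of u * v is only determined when u * v is nonzero, hence the
   proviso in [pts_add]. *)
Record poisson_twisting_system : Prop := PoissonTwistingSystem {
  pts_der : forall g, poisson_derivation br (delta g);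
  pts_graded : forall g h u, piece h u -> piece h (delta g u);
  pts_comm : forall g h u, delta g (delta h u) = delta h (delta g u);
  pts_add : forall g h u v, piece g u -> piece h v -> u * v != 0 ->
    forall w, delta (g + h) w = delta g w + delta h w }.

Definition is_poisson_twist (tw : A -> A -> A) : Prop :=
  poisson_bracket tw /\
  forall g h u v, piece g u -> piece h v ->
    tw u v = br u v + u * delta g v - v * delta h u.

End Twist.

(* The variable of index [lshift n i] is x_i, that of index [rshift n i] is
   y_i. *)
Section Algebra.
Variables (K : fieldType) (R : comAlgType K) (n : nat) (a : 'I_n -> R).

Local Notation P := {mpoly R[n + n]}.
Implicit Types (f g : P).

Definition tgwpa_rel (i : 'I_n) : P :=
  'X_(rshift n i) * 'X_(lshift n i) - (a i)%:MP.

Definition tgwpa_ideal : pred P :=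
  fun f => `[< exists c : 'I_n -> P, f = \sum_i c i * tgwpa_rel i >].

Definition tgwpa_point (k : 'I_(n + n)) : R :=
  match split k with inl i => a i | inr _ => 1 end.

Lemma tgwpa_ideal_meval f : f \in tgwpa_ideal -> f.@[tgwpa_point] = 0.
Proof.
move=> /asboolP[c ->]; rewrite raddf_sum big1 //= => i _.
rewrite mevalM mevalB mevalM !mevalXU mevalC /tgwpa_point.
by rewrite -[lshift n i]/(unsplit (inl i)) -[rshift n i]/(unsplit (inr i))
  !unsplitK mul1r subrr mulr0.
Qed.

Lemma tgwpa_idealr_closed : idealr_closed tgwpa_ideal.
Proof.
split=> [||f u v /asboolP[c ->] /asboolP[d ->]].
- by apply/asboolP; exists (fun=> 0); rewrite big1 // => i _; rewrite mul0r.
- apply/negP => /tgwpa_ideal_meval; rewrite meval1 => /eqP.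
  by rewrite oner_eq0.
- apply/asboolP; exists (fun i => f * c i + d i).
  rewrite mulr_sumr -big_split /=; apply: eq_bigr => i _.
  by rewrite mulrDl mulrA.
Qed.

HB.instance Definition _ := isIdealr.Build P tgwpa_ideal tgwpa_idealr_closed.

Definition tgwpa_idealr : idealr P := tgwpa_ideal.

Definition tgwpa_alg : Type := {ideal_quot tgwpa_idealr}.

HB.instance Definition _ := GRing.ComNzRing.on tgwpa_alg.

Definition tgwpa_pi (f : P) : tgwpa_alg := \pi_{ideal_quot tgwpa_idealr} f.
Definition tgwpa_C (r : R) : tgwpa_alg := tgwpa_pi r%:MP.
Definition tgwpa_x (i : 'I_n) : tgwpa_alg := tgwpa_pi 'X_(lshift n i).
Definition tgwpa_y (i : 'I_n) : tgwpa_alg := tgwpa_pi 'X_(rshift n i).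

Lemma tgwpa_pi_is_zmod_morphism : zmod_morphism tgwpa_pi.
Proof. exact: rmorphB. Qed.
Lemma tgwpa_pi_is_monoid_morphism : monoid_morphism tgwpa_pi.
Proof. by split; [exact: rmorph1 | exact: rmorphM]. Qed.
HB.instance Definition _ :=
  GRing.isZmodMorphism.Build P tgwpa_alg tgwpa_pi tgwpa_pi_is_zmod_morphism.
HB.instance Definition _ :=
  GRing.isMonoidMorphism.Build P tgwpa_alg tgwpa_pi tgwpa_pi_is_monoid_morphism.

HB.instance Definition _ := GRing.RMorphism.copy tgwpa_C
  (tgwpa_pi \o @mpolyC (n + n) R).

Definition tgwpa_scale (c : K) (u : tgwpa_alg) : tgwpa_alg := tgwpa_C c%:A * u.

Lemma tgwpa_scaleA c d u :
  tgwpa_scale c (tgwpa_scale d u) = tgwpa_scale (c * d) u.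
Proof.
by rewrite /tgwpa_scale mulrA -rmorphM /= -scalerAl mul1r scalerA.
Qed.
Lemma tgwpa_scale1 : left_id 1 tgwpa_scale.
Proof. by move=> u; rewrite /tgwpa_scale scale1r rmorph1 mul1r. Qed.
Lemma tgwpa_scaleDr : right_distributive tgwpa_scale +%R.
Proof. by move=> c u v; rewrite /tgwpa_scale mulrDr. Qed.
Lemma tgwpa_scaleDl u : {morph tgwpa_scale^~ u : c d / c + d}.
Proof. by move=> c d; rewrite /tgwpa_scale scalerDl rmorphD mulrDl. Qed.
HB.instance Definition _ := GRing.Zmodule_isLmodule.Build K tgwpa_alg
  tgwpa_scaleA tgwpa_scale1 tgwpa_scaleDr tgwpa_scaleDl.

Lemma tgwpa_scaleAl (c : K) (u v : tgwpa_alg) : c *: (u * v) = (c *: u) * v.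
Proof. exact: mulrA. Qed.
HB.instance Definition _ :=
  GRing.Lmodule_isLalgebra.Build K tgwpa_alg tgwpa_scaleAl.
HB.instance Definition _ := GRing.Lalgebra_isComAlgebra.Build K tgwpa_alg.

Lemma tgwpa_yx i : tgwpa_y i * tgwpa_x i = tgwpa_C (a i).
Proof.
apply/eqP; rewrite -subr_eq0 -rmorphM -rmorphB; apply/eqP.
rewrite -(rmorph0 tgwpa_pi); apply/eqP; rewrite -Quotient.idealrBE subr0.
apply/asboolP; exists (fun j => (j == i)%:R).
rewrite (bigD1 i) //= eqxx mul1r big1 ?addr0 // => j /negPf ->.
by rewrite mul0r.
Qed.

Lemma tgwpa_C_inj : injective tgwpa_C.
Proof.
move=> r s /eqP; rewrite -Quotient.idealrBE => /tgwpa_ideal_meval.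
by rewrite mevalB !mevalC => /eqP; rewrite subr_eq0 => /eqP.
Qed.

Definition tgwpa_mdeg (m : 'X_{1..n + n}) : 'rV[int]_n :=
  \row_i ((m (lshift n i))%:Z - (m (rshift n i))%:Z).

Definition tgwpa_homog (alpha : 'rV[int]_n) (u : tgwpa_alg) : Prop :=
  exists2 f : P, {in msupp f, forall m, tgwpa_mdeg m = alpha} & u = tgwpa_pi f.

Lemma tgwpa_homogC r : tgwpa_homog 0 (tgwpa_C r).
Proof.
exists r%:MP => // m; rewrite msuppC; case: ifP => // _.
rewrite inE => /eqP ->; apply/rowP => i; rewrite !mxE !mnm0E.
by rewrite subrr.
Qed.

(* The degree 0 component is R, so that degree-preserving maps restrict to
   R. *)
Lemma tgwpa_homog0P u : tgwpa_homog 0 u -> exists r, u = tgwpa_C r.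
Proof.
case=> f f0 ->; rewrite [f]mpolyE rmorph_sum /= big_seq.
elim/big_rec: _ => [|m v mf [s ->]]; first by exists 0; rewrite rmorph0.
suff [r Er] : exists r, tgwpa_pi 'X_[m] = tgwpa_C r.
  exists (f@_m * r + s); rewrite -mul_mpolyC rmorphM /= Er.
  by rewrite (rmorphD tgwpa_C) (rmorphM tgwpa_C).
exists (\prod_i a i ^+ m (rshift n i)).
rewrite mpolyXE_id big_split_ord /= -big_split /= !rmorph_prod /=.
apply: eq_bigr => i _; move/rowP/(_ i): (f0 m mf); rewrite !mxE => /eqP.
rewrite subr_eq0 => /eqP[->].
by rewrite rmorphM !rmorphXn -exprMn mulrC tgwpa_yx.
Qed.

Definition tgwpa_restr (d : tgwpa_alg -> tgwpa_alg) (r : R) : R :=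
  xget 0 [set s | tgwpa_C s = d (tgwpa_C r)]%classic.

Lemma tgwpa_restrE d :
  (forall u, tgwpa_homog 0 u -> tgwpa_homog 0 (d u)) ->
  forall r, tgwpa_C (tgwpa_restr d r) = d (tgwpa_C r).
Proof.
move=> d0 r; have [s Es] := tgwpa_homog0P (d0 _ (tgwpa_homogC r)).
exact: (@xgetPex _ 0 [set s | tgwpa_C s = d (tgwpa_C r)]%classic
  (ex_intro _ s (esym Es))).
Qed.

End Algebra.

Record tgwpa_datum (K : fieldType) (R : comAlgType K) (n : nat)
    (brR : R -> R -> R) (D : 'I_n -> R -> R) (a : 'I_n -> R)
    (mu gamma : 'I_n -> 'I_n -> K) : Prop := TGWPADatum {
  tgwpa_brR : poisson_bracket brR;
  tgwpa_D_der : forall i, poisson_derivation brR (D i);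
  tgwpa_D_comm : forall i j r, D i (D j r) = D j (D i r);
  tgwpa_a_central : forall i, poisson_central brR (a i);
  tgwpa_a_regular : forall i, GRing.lreg (a i);
  tgwpa_Da : forall i j, i != j -> D j (a i) = gamma i j *: a i;
  tgwpa_gammamu : forall i j, i != j ->
    gamma i j + gamma j i = mu i j + mu j i }.

(* Being a biderivation, a bracket satisfying these conditions is determined by
   its values on the generators of the algebra. *)
Record is_tgwpa_bracket (K : fieldType) (R : comAlgType K) (n : nat)
    (brR : R -> R -> R) (D : 'I_n -> R -> R) (a : 'I_n -> R)
    (mu gamma : 'I_n -> 'I_n -> K)
    (br : tgwpa_alg a -> tgwpa_alg a -> tgwpa_alg a) : Prop :=
    IsTGWPABracket {
  tgwpa_br : poisson_bracket br;
  tgwpa_brCC : forall r s, br (tgwpa_C a r) (tgwpa_C a s) = tgwpa_C a (brR r s);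
  tgwpa_brCx : forall r i,
    br (tgwpa_C a r) (tgwpa_x a i) = tgwpa_C a (D i r) * tgwpa_x a i;
  tgwpa_brCy : forall r i,
    br (tgwpa_C a r) (tgwpa_y a i) = - (tgwpa_C a (D i r) * tgwpa_y a i);
  tgwpa_bryx_diag : forall i,
    br (tgwpa_y a i) (tgwpa_x a i) = tgwpa_C a (D i (a i));
  tgwpa_bryx : forall i j, i != j ->
    br (tgwpa_y a i) (tgwpa_x a j) = mu i j *: (tgwpa_x a j * tgwpa_y a i);
  tgwpa_brxx : forall i j, i != j ->
    br (tgwpa_x a i) (tgwpa_x a j) =
      (gamma i j - mu i j) *: (tgwpa_x a i * tgwpa_x a j);
  tgwpa_bryy : forall i j, i != j ->
    br (tgwpa_y a i) (tgwpa_y a j) =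
      (mu j i - gamma i j) *: (tgwpa_y a i * tgwpa_y a j) }.

Arguments tgwpa_homog {K R n} a alpha u.
Arguments is_tgwpa_bracket {K R n} brR D a mu gamma br.

(* Main.v *)
(** For each i let E_i be the derivation of the TGWPA acting on the component of
    degree alpha as multiplication by alpha_i.  Since
    delta_alpha = sum_i alpha_i delta_{e_i}, the twisted bracket is
    brA + sum_i E_i /\ delta_{e_i}, and adding the wedge of two commuting Poisson
    derivations to a Poisson bracket gives a Poisson bracket again.  Evaluating
    on the generators shows that every Poisson twist satisfies the relations of
    A_nu(R, nabla, a); as a biderivation is determined by its values on the
    generators, the identity map is the required isomorphism. *)

Require Import Defs.
From HB Require Import structures.
From mathcomp Require Import all_boot all_order all_algebra.
From mathcomp Require Import mpoly.
From mathcomp Require Import boolp classical_sets.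
From mathcomp Require Import ring.

Set Implicit Arguments.
Unset Strict Implicit.
Unset Printing Implicit Defensive.

Import GRing.Theory.
Local Open Scope ring_scope.

(** * Derivations, Poisson brackets, and adding wedges of derivations to a bracket *)

Section PoissonTheory.
Variables (K : fieldType) (A : comAlgType K).
Implicit Types (br : A -> A -> A) (d e : A -> A).

Lemma derivationD d : derivation d -> {morph d : u v / u + v}.
Proof. by case=> dl _ u v; have := dl 1 u v; rewrite !scale1r. Qed.

Lemma derivation0 d : derivation d -> d 0 = 0.
Proof.
by move=> hd; apply: (addrI (d 0)); rewrite -(derivationD hd) !addr0.
Qed.

Lemma derivationZ d : derivation d -> forall c u, d (c *: u) = c *: d u.
Proof.
by move=> hd c u; have := hd.1 c u 0; rewrite !addr0 (derivation0 hd) addr0.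
Qed.

Lemma derivationN d : derivation d -> {morph d : u / - u}.
Proof. by move=> hd u; rewrite -scaleN1r (derivationZ hd) scaleN1r. Qed.

Lemma derivationB d : derivation d -> {morph d : u v / u - v}.
Proof. by move=> hd u v; rewrite (derivationD hd) (derivationN hd). Qed.

Lemma derivationM d : derivation d -> forall u v, d (u * v) = d u * v + u * d v.
Proof. by case. Qed.

Lemma derivation1 d : derivation d -> d 1 = 0.
Proof.
move=> hd; apply: (addrI (d 1)).
by rewrite addr0 -[in RHS](mulr1 1) (derivationM hd) mulr1 mul1r.
Qed.

Lemma derivation_add d e :
  derivation d -> derivation e -> derivation (fun u => d u + e u).
Proof.
move=> hd he; split=> [c u v|u v]; last first.
  by rewrite (derivationM hd) (derivationM he); ring.
rewrite (derivationD hd) (derivationD he) (derivationZ hd) (derivationZ he).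
by rewrite scalerDr addrACA.
Qed.

Lemma derivation_opp d : derivation d -> derivation (fun u => - d u).
Proof.
move=> hd; split=> [c u v|u v]; last first.
  by rewrite (derivationM hd); ring.
by rewrite (derivationD hd) (derivationZ hd) opprD scalerN.
Qed.

Lemma derivation_mull c d : derivation d -> derivation (fun u => c * d u).
Proof.
move=> hd; split=> [k u v|u v]; last first.
  by rewrite (derivationM hd); ring.
by rewrite (derivationD hd) (derivationZ hd) mulrDr scalerAr.
Qed.

(** Reduces the commutation of two derivations to a check on algebra generators, since a derivation
    that kills the generators is zero. *)
Lemma derivation_commutator d e : derivation d -> derivation e ->
  derivation (fun u => d (e u) - e (d u)).
Proof.
move=> hd he; split=> [c u v|u v].
  rewrite !(derivationD hd, derivationD he, derivationZ hd, derivationZ he).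
  by rewrite opprD addrACA -scalerBr.
rewrite !(derivationM hd, derivationM he).
by rewrite !(derivationD hd, derivationD he, derivationM hd, derivationM he); ring.
Qed.

Lemma poisson_bracketC br : poisson_bracket br -> forall u v, br u v = - br v u.
Proof.
move=> hbr u v; apply/eqP; rewrite -addr_eq0; apply/eqP.
have := pbr_alt hbr (u + v); rewrite (derivationD (pbr_der hbr _)).
have brDl w : {morph br^~ w : x y / x + y}.
  by move=> x y; have := pbr_linearl hbr w 1 x y; rewrite !scale1r.
by rewrite !brDl !(pbr_alt hbr) add0r addr0 addrC.
Qed.

Lemma poisson_bracket_derl br : poisson_bracket br ->
  forall v, derivation (br^~ v).
Proof.
move=> hbr v; split; first exact: (pbr_linearl hbr).
move=> u w; rewrite (poisson_bracketC hbr) (derivationM (pbr_der hbr _)).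
rewrite (poisson_bracketC hbr u) (poisson_bracketC hbr w).
ring.
Qed.

Lemma poisson_derivationB br d e :
  poisson_derivation br d -> poisson_derivation br e ->
  (forall u v, br u v = - br v u) -> (forall u, derivation (br u)) ->
  poisson_derivation br (fun u => d u - e u).
Proof.
move=> [hd dbr] [he ebr] brC brd; split.
  by apply: derivation_add => //; apply: derivation_opp.
move=> u v; rewrite dbr ebr !(brC (_ - _)) !(derivationB (brd _)).
rewrite !(brC _ (d u)) !(brC _ (e u)); ring.
Qed.

Definition wedge_bracket br d e u v := br u v + (d u * e v - d v * e u).

(** In the Jacobi sum, the terms mixing [br] with the wedge cancel because [d] and [e] are Poisson
    derivations, and the terms quadratic in the wedge cancel because [d] and [e] commute. *)
Lemma poisson_bracket_wedge br d e : poisson_bracket br ->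
  poisson_derivation br d -> poisson_derivation br e ->
  (forall u, d (e u) = e (d u)) -> poisson_bracket (wedge_bracket br d e).
Proof.
move=> hbr [hd dbr] [he ebr] deC.
have brd u : derivation (br u) := pbr_der hbr u.
have brC := poisson_bracketC hbr.
rewrite /wedge_bracket; split.
- move=> v; suff [] : derivation (fun u => br u v + (d u * e v - d v * e u)) by [].
  apply: derivation_add; first exact: poisson_bracket_derl.
  have := derivation_add (derivation_mull (e v) hd)
    (derivation_opp (derivation_mull (d v) he)).
  by congr derivation; apply/funext => u; rewrite mulrC.
- move=> u; apply: derivation_add => //.
  have := derivation_add (derivation_mull (d u) he)
    (derivation_opp (derivation_mull (e u) hd)).
  by congr derivation; apply/funext => v; rewrite (mulrC (e u)).
- by move=> u; rewrite (pbr_alt hbr) subrr addr0.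
move=> u v w; rewrite -[RHS](pbr_jacobi hbr u v w).
(* The three expansions share one normal form: a differentiated argument of [br] stands on the
   right, and [d (e _)] becomes [e (d _)]. The remaining brackets are then atoms for [ring]. *)
have hbrw x y z : br x (br y z + (d y * e z - d z * e y)) =
    br x (br y z) + (br x (d y) * e z + d y * br x (e z)
      - (br x (d z) * e y + d z * br x (e y))).
  by rewrite (derivationD (brd x)) (derivationB (brd x)) !(derivationM (brd x)).
have hdw y z : d (br y z + (d y * e z - d z * e y)) =
    - br z (d y) + br y (d z) + (d (d y) * e z + d y * e (d z)
      - (d (d z) * e y + d z * e (d y))).
  rewrite (derivationD hd) (derivationB hd) !(derivationM hd) dbr !deC.
  by rewrite (brC (d y)).
have hew y z : e (br y z + (d y * e z - d z * e y)) =
    - br z (e y) + br y (e z) + (e (d y) * e z + d y * e (e z)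
      - (e (d z) * e y + d z * e (e y))).
  rewrite (derivationD he) (derivationB he) !(derivationM he) ebr.
  by rewrite (brC (e y)).
rewrite !hbrw !hdw !hew; ring.
Qed.

(** A derivation commuting with [d] and [e] annihilates their wedge, so it stays Poisson after the
    wedge is added. This allows wedges to be added one after another. *)
Lemma poisson_derivation_wedge br d e f :
  poisson_derivation br f -> derivation d -> derivation e ->
  (forall u, f (d u) = d (f u)) -> (forall u, f (e u) = e (f u)) ->
  poisson_derivation (wedge_bracket br d e) f.
Proof.
move=> [hf fbr] hd he fd fe; split=> // u v; rewrite /wedge_bracket.
rewrite (derivationD hf) (derivationB hf) !(derivationM hf) fbr !fd !fe.
ring.
Qed.

Lemma poisson_bracket_sum_wedge (I : Type) (s : seq I) (d e : I -> A -> A) br :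
  poisson_bracket br ->
  (forall i, poisson_derivation br (d i)) ->
  (forall i, poisson_derivation br (e i)) ->
  (forall i j u, d i (d j u) = d j (d i u)) ->
  (forall i j u, e i (e j u) = e j (e i u)) ->
  (forall i j u, d i (e j u) = e j (d i u)) ->
  poisson_bracket
    (fun u v => br u v + \sum_(i <- s) (d i u * e i v - d i v * e i u)).
Proof.
move=> hbr hd he ddC eeC deC; pose brs s' u v :=
  br u v + \sum_(i <- s') (d i u * e i v - d i v * e i u).
have brs_cons i s' : brs (i :: s') = wedge_bracket (brs s') (d i) (e i).
  apply/funext => u; apply/funext => v.
  by rewrite /brs /wedge_bracket big_cons (addrC (_ - _)) addrA.
(* The induction is strengthened: adding the next wedge requires the next [d i] and [e i] to be
   Poisson for the partial sum, not just for [br]. *)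
suff [] : poisson_bracket (brs s) /\ forall f, poisson_derivation br f ->
    (forall i u, f (d i u) = d i (f u)) ->
    (forall i u, f (e i u) = e i (f u)) -> poisson_derivation (brs s) f.
  by [].
elim: s => [|i s' [IHbr IHder]].
  have -> : brs [::] = br.
    by apply/funext => u; apply/funext => v; rewrite /brs big_nil addr0.
  by [].
rewrite brs_cons; split.
  apply: poisson_bracket_wedge => //; first exact: IHder.
  by apply: IHder => // j u; rewrite deC.
move=> f hf fd fe; apply: poisson_derivation_wedge => //.
- exact: IHder.
- by case: (hd i).
- by case: (he i).
Qed.

End PoissonTheory.

(** * Vanishing on generators, and the weight derivations of the TGWPA *)

Section WeightDerivation.
Variables (K : fieldType) (R : comAlgType K) (n : nat) (a : 'I_n -> R).
Local Notation P := {mpoly R[n + n]}.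
Local Notation A := (tgwpa_alg a).
Local Notation C := (tgwpa_C a).
Local Notation x := (tgwpa_x a).
Local Notation y := (tgwpa_y a).

Lemma tgwpa_scaleE (c : K) (u : A) : c *: u = C c%:A * u.
Proof. by []. Qed.

Lemma tgwpa_CZ (c : K) r : C (c *: r) = c *: C r.
Proof. by rewrite tgwpa_scaleE -rmorphM /= -scalerAl mul1r. Qed.

Lemma tgwpa_CD : {morph C : r s / r + s}.
Proof. exact: rmorphD. Qed.

Lemma tgwpa_CB : {morph C : r s / r - s}.
Proof. exact: rmorphB. Qed.

Lemma tgwpa_CM : {morph C : r s / r * s}.
Proof. exact: rmorphM. Qed.

Lemma tgwpa_piP (u : A) : exists f : P, u = tgwpa_pi a f.
Proof. by exists (repr u); rewrite /tgwpa_pi reprK. Qed.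

Lemma tgwpa_homogx i : tgwpa_homog a (delta_mx 0 i) (x i).
Proof.
exists 'X_(lshift n i) => // m; rewrite msuppX inE => /eqP ->.
apply/rowP => j; rewrite !mxE !mnm1E eq_lshift eq_lrshift subr0 eqxx eq_sym.
by case: eqP.
Qed.

Lemma tgwpa_homogy i : tgwpa_homog a (- delta_mx 0 i) (y i).
Proof.
exists 'X_(rshift n i) => // m; rewrite msuppX inE => /eqP ->.
apply/rowP => j; rewrite !mxE !mnm1E eq_rshift eq_rlshift sub0r eqxx eq_sym.
by case: eqP.
Qed.

(** By the Leibniz rule the zeros of [d] are closed under products, and every element is a sum of
    products of generators. As [d] is only [K]-linear, the coefficients from [R] count among the
    generators. *)
Lemma tgwpa_derivation_eq0 (d : A -> A) : derivation d ->
  (forall r, d (C r) = 0) -> (forall i, d (x i) = 0) ->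
  (forall i, d (y i) = 0) -> forall u, d u = 0.
Proof.
move=> hd dC dx dy u; have [f ->] := tgwpa_piP u.
have dmul v w : d v = 0 -> d w = 0 -> d (v * w) = 0.
  by move=> dv dw; rewrite (derivationM hd) dv dw mul0r mulr0 addr0.
elim/mpolyind: f => [|c m f _ _ IH]; first by rewrite rmorph0 (derivation0 hd).
rewrite rmorphD (derivationD hd) IH addr0 -mul_mpolyC rmorphM.
apply: (dmul _ _); first exact: dC.
rewrite mpolyXE_id rmorph_prod.
apply: (big_ind (fun v => d v = 0)) => [|v w|k _].
- exact: derivation1.
- exact: dmul.
rewrite rmorphXn; elim: (m k) => [|j IHj]; first by rewrite expr0 (derivation1 hd).
rewrite exprS; apply: (dmul _ _) => //.
by rewrite -[k]splitK; case: (split k) => l; [exact: dx|exact: dy].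
Qed.

Lemma tgwpa_biderivation_eq0 (b : A -> A -> A) :
  (forall u, derivation (b u)) -> (forall u v, b u v = - b v u) ->
  (forall r s, b (C r) (C s) = 0) ->
  (forall r i, b (C r) (x i) = 0) -> (forall r i, b (C r) (y i) = 0) ->
  (forall i j, b (y i) (x j) = 0) ->
  (forall i j, b (x i) (x j) = 0) -> (forall i j, b (y i) (y j) = 0) ->
  forall u v, b u v = 0.
Proof.
move=> hb bC bCC bCx bCy byx bxx byy u v.
(* With the second argument now a generator, skew-symmetry exchanges the arguments and the same
   principle applies to the other one. *)
apply: tgwpa_derivation_eq0 => // [r|i|i]; rewrite bC; apply/eqP;
  rewrite oppr_eq0; apply/eqP; apply: tgwpa_derivation_eq0 => // j.
- by rewrite bC bCx oppr0.
- by rewrite bC byx oppr0.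
- by rewrite bC bCy oppr0.
Qed.

(** The Euler operator of the i-th coordinate of the degree, acting before passing to the
    quotient. *)
Definition mpoly_weight (i : 'I_n) (f : P) : P :=
  'X_(lshift n i) * f^`M(lshift n i) - 'X_(rshift n i) * f^`M(rshift n i).

Lemma mpoly_weightD i : {morph mpoly_weight i : f g / f + g}.
Proof.
by move=> f g; rewrite /mpoly_weight !mderivD !mulrDr opprD addrACA.
Qed.

Lemma mpoly_weightM i f g :
  mpoly_weight i (f * g) = mpoly_weight i f * g + f * mpoly_weight i g.
Proof. by rewrite /mpoly_weight !mderivM; ring. Qed.

Lemma mpoly_weightC i r : mpoly_weight i r%:MP = 0.
Proof. by rewrite /mpoly_weight !mderivC !mulr0 subrr. Qed.

Lemma mpoly_weightX i m : mpoly_weight i 'X_[m] = 'X_[m] *~ (tgwpa_mdeg m 0 i).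
Proof.
have eulerX k : 'X_k * 'X_[m]^`M(k) = 'X_[m] *+ m k :> P.
  (* Subtraction of exponents is truncated, so the variable can be multiplied back only when its
     exponent is positive; for exponent 0 both sides vanish. *)
  rewrite mderivX scaler_nat; have [->|mk] := eqVneq (m k) 0%N.
    by rewrite !mulr0n mulr0.
  by rewrite mulrnAr -mpolyXD addmC submK // lep1mP.
by rewrite /mpoly_weight !eulerX mxE mulrzBr.
Qed.

(** The relations y_j x_j - a_j are homogeneous of degree 0, hence killed by the Euler operator,
    which therefore acts only on the coefficients [c j]. *)
Lemma mpoly_weight_ideal i f :
  f \in tgwpa_ideal a -> mpoly_weight i f \in tgwpa_ideal a.
Proof.
move=> /asboolP[c ->]; apply/asboolP; exists (fun j => mpoly_weight i (c j)).
rewrite (big_morph _ (mpoly_weightD i) (mpoly_weightC i 0)).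
apply: eq_bigr => j _; rewrite mpoly_weightM.
suff -> : mpoly_weight i (tgwpa_rel a j) = 0 by rewrite mulr0 addr0.
rewrite /tgwpa_rel mpoly_weightD -mpolyCN mpoly_weightC addr0 -mpolyXD.
rewrite mpoly_weightX mxE !mnmDE !mnm1E !eq_lshift !eq_rshift.
by rewrite eq_lrshift eq_rlshift addn0 add0n subrr mulr0z.
Qed.

(** A representative is chosen here; stability of the ideal makes the result independent of the
    choice ([tgwpa_weight_pi]). *)
Definition tgwpa_weight (i : 'I_n) (u : A) : A :=
  tgwpa_pi a (mpoly_weight i (repr u)).

Lemma tgwpa_weight_pi i f :
  tgwpa_weight i (tgwpa_pi a f) = tgwpa_pi a (mpoly_weight i f).
Proof.
apply/eqP; rewrite -Quotient.idealrBE.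
have -> g : mpoly_weight i g - mpoly_weight i f = mpoly_weight i (g - f).
  by rewrite /mpoly_weight !mderivB; ring.
apply: mpoly_weight_ideal; rewrite Quotient.idealrBE; apply/eqP.
by rewrite reprK.
Qed.

Lemma tgwpa_weightC i r : tgwpa_weight i (C r) = 0.
Proof. by rewrite /tgwpa_C tgwpa_weight_pi mpoly_weightC rmorph0. Qed.

Lemma tgwpa_weight_der i : derivation (tgwpa_weight i).
Proof.
have wD u v : tgwpa_weight i (u + v) = tgwpa_weight i u + tgwpa_weight i v.
  have [f ->] := tgwpa_piP u; have [g ->] := tgwpa_piP v.
  by rewrite -rmorphD !tgwpa_weight_pi mpoly_weightD rmorphD.
have wM u v :
    tgwpa_weight i (u * v) = tgwpa_weight i u * v + u * tgwpa_weight i v.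
  have [f ->] := tgwpa_piP u; have [g ->] := tgwpa_piP v.
  by rewrite -rmorphM !tgwpa_weight_pi mpoly_weightM rmorphD !rmorphM.
(* Scaling is multiplication by an element of [R], which has weight 0, so [K]-linearity follows from
   the Leibniz rule. *)
by split=> // c u v; rewrite wD !tgwpa_scaleE wM tgwpa_weightC mul0r add0r.
Qed.

Lemma tgwpa_weight_homog i alpha u :
  tgwpa_homog a alpha u -> tgwpa_weight i u = u *~ alpha 0 i.
Proof.
case=> f falpha ->; rewrite tgwpa_weight_pi -rmorphMz; congr tgwpa_pi.
rewrite [f]mpolyE (big_morph _ (mpoly_weightD i) (mpoly_weightC i 0)).
rewrite mulrz_suml !big_seq; apply: eq_bigr => m mf.
rewrite -mul_mpolyC mpoly_weightM mpoly_weightC mul0r add0r mpoly_weightX.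
by rewrite falpha // mulrzAr.
Qed.

End WeightDerivation.

(** * Uniqueness and homogeneity of TGWPA brackets; restriction of derivations to [R] *)

Section Bracket.
Variables (K : fieldType) (R : comAlgType K) (n : nat) (a : 'I_n -> R).
Variables (brR : R -> R -> R) (D : 'I_n -> R -> R) (mu gamma : 'I_n -> 'I_n -> K).
Local Notation A := (tgwpa_alg a).
Local Notation C := (tgwpa_C a).
Local Notation x := (tgwpa_x a).
Local Notation y := (tgwpa_y a).

Lemma is_tgwpa_bracket_inj br1 br2 : is_tgwpa_bracket brR D a mu gamma br1 ->
  is_tgwpa_bracket brR D a mu gamma br2 -> forall u v, br1 u v = br2 u v.
Proof.
move=> h1 h2 u v; apply/eqP; rewrite -subr_eq0; apply/eqP.
have P1 := tgwpa_br h1; have P2 := tgwpa_br h2.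
apply: (tgwpa_biderivation_eq0 (b := fun u v => br1 u v - br2 u v)).
- by move=> w; apply: derivation_add;
    [exact: pbr_der | apply: derivation_opp; exact: pbr_der].
- by move=> w z; rewrite (poisson_bracketC P1) (poisson_bracketC P2) opprB opprK addrC.
- by move=> r s; rewrite (tgwpa_brCC h1) (tgwpa_brCC h2) subrr.
- by move=> r i; rewrite (tgwpa_brCx h1) (tgwpa_brCx h2) subrr.
- by move=> r i; rewrite (tgwpa_brCy h1) (tgwpa_brCy h2) subrr.
- move=> i j; have [->|ij] := eqVneq i j.
    by rewrite (tgwpa_bryx_diag h1) (tgwpa_bryx_diag h2) subrr.
  by rewrite (tgwpa_bryx h1) // (tgwpa_bryx h2) // subrr.
- move=> i j; have [->|ij] := eqVneq i j.
    by rewrite (pbr_alt P1) (pbr_alt P2) subrr.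
  by rewrite (tgwpa_brxx h1) // (tgwpa_brxx h2) // subrr.
- move=> i j; have [->|ij] := eqVneq i j.
    by rewrite (pbr_alt P1) (pbr_alt P2) subrr.
  by rewrite (tgwpa_bryy h1) // (tgwpa_bryy h2) // subrr.
Qed.

Lemma tgwpa_weightx i j : tgwpa_weight i (x j) = (i == j)%:R *: x j.
Proof.
rewrite (tgwpa_weight_homog i (tgwpa_homogx a j)) mxE eqxx.
by case: (i == j); rewrite (mulr1z, mulr0z) (scale1r, scale0r).
Qed.

Lemma tgwpa_weighty i j : tgwpa_weight i (y j) = - (i == j)%:R *: y j.
Proof.
rewrite (tgwpa_weight_homog i (tgwpa_homogy a j)) !mxE eqxx mulrNz scaleNr.
by case: (i == j); rewrite (mulr1z, mulr0z) (scale1r, scale0r).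
Qed.

Lemma tgwpa_weight_comm i j (u : A) :
  tgwpa_weight i (tgwpa_weight j u) = tgwpa_weight j (tgwpa_weight i u).
Proof.
have hi := tgwpa_weight_der a i; have hj := tgwpa_weight_der a j.
apply/eqP; rewrite -subr_eq0; apply/eqP; move: u.
apply: tgwpa_derivation_eq0; first exact: derivation_commutator.
- by move=> r; rewrite !tgwpa_weightC (derivation0 hi) (derivation0 hj) subrr.
- move=> k; rewrite !tgwpa_weightx (derivationZ hi) (derivationZ hj).
  by rewrite !tgwpa_weightx !scalerA mulrC subrr.
- move=> k; rewrite !tgwpa_weighty (derivationZ hi) (derivationZ hj).
  by rewrite !tgwpa_weighty !scalerA mulrC subrr.
Qed.

(* The bracket is homogeneous: its failure to commute with a weight derivation
   is a biderivation vanishing on the generators. *)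
Lemma tgwpa_weight_poisson br i : is_tgwpa_bracket brR D a mu gamma br ->
  poisson_derivation br (tgwpa_weight i).
Proof.
move=> h; have hP := tgwpa_br h; have brC := poisson_bracketC hP.
have hw := tgwpa_weight_der a i; split=> // u v.
have brd w : derivation (br w) := pbr_der hP w.
have brZl c w z : br (c *: w) z = c *: br w z.
  exact: (derivationZ (poisson_bracket_derl hP z)).
apply/eqP; rewrite -subr_eq0 opprD addrA; apply/eqP; move: u v.
pose b u v := tgwpa_weight i (br u v) - br (tgwpa_weight i u) v
  - br u (tgwpa_weight i v).
(* The generators are eigenvectors of the weight derivation, so on them the defect [b] vanishes once
   the weight of the bracket is the sum of the two weights. *)
have bxy (c d e : K) u v : tgwpa_weight i u = c *: u ->
    tgwpa_weight i v = d *: v -> tgwpa_weight i (br u v) = e *: br u v ->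
    e = c + d -> b u v = 0.
  move=> Eu Ev Ebr Ee; rewrite /b Ebr Ee Eu Ev brZl (derivationZ (brd u)).
  by rewrite scalerDl addrAC addrK subrr.
have wM (c d : K) (u v : A) : tgwpa_weight i u = c *: u ->
    tgwpa_weight i v = d *: v -> tgwpa_weight i (u * v) = (c + d) *: (u * v).
  move=> Eu Ev.
  by rewrite (derivationM hw) Eu Ev -scalerAl -scalerAr scalerDl.
have wC r : tgwpa_weight i (C r) = (0 : K) *: C r.
  by rewrite tgwpa_weightC scale0r.
have wx := tgwpa_weightx i; have wy := tgwpa_weighty i.
have wZ (k c : K) (u : A) : tgwpa_weight i u = c *: u ->
    tgwpa_weight i (k *: u) = c *: (k *: u).
  by move=> Eu; rewrite (derivationZ hw) Eu !scalerA mulrC.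
apply: (tgwpa_biderivation_eq0 (b := b)).
- move=> w; have := derivation_add (derivation_commutator hw (brd w))
    (derivation_opp (brd (tgwpa_weight i w))).
  by congr derivation; apply/funext => v; rewrite /b addrAC.
- move=> u v; rewrite /b (brC u v) (derivationN hw) (brC _ v) (brC u).
  by rewrite !opprD !opprK addrAC.
- by move=> r s; apply: (bxy 0 0 0) => //; rewrite ?addr0 // (tgwpa_brCC h).
- move=> r j; apply: (bxy 0 (i == j)%:R (0 + (i == j)%:R)) => //.
  by rewrite (tgwpa_brCx h); apply: wM.
- move=> r j; apply: (bxy 0 (- (i == j)%:R) (0 - (i == j)%:R)) => //.
  by rewrite (tgwpa_brCy h) -scaleN1r; apply: wZ; apply: wM.
- move=> j k; have [->|jk] := eqVneq j k.
    (* On the diagonal the bracket lies in [R], of weight 0, and the weights of y_k and x_k are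
       opposite. *)
    apply: (bxy (- (i == k)%:R) (i == k)%:R 0); rewrite ?addNr //.
    by rewrite (tgwpa_bryx_diag h).
  apply: (bxy (- (i == j)%:R) (i == k)%:R (- (i == j)%:R + (i == k)%:R)) => //.
  by rewrite (tgwpa_bryx h) //; apply: wZ; rewrite addrC; apply: wM.
- move=> j k; have [->|jk] := eqVneq j k.
    by rewrite /b !wx brZl (derivationZ (brd _)) (pbr_alt hP) !scaler0
      (derivation0 hw) !subr0.
  apply: (bxy (i == j)%:R (i == k)%:R ((i == j)%:R + (i == k)%:R)) => //.
  by rewrite (tgwpa_brxx h) //; apply: wZ; apply: wM.
- move=> j k; have [->|jk] := eqVneq j k.
    by rewrite /b !wy brZl (derivationZ (brd _)) (pbr_alt hP) !scaler0
      (derivation0 hw) !subr0.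
  apply: (bxy (- (i == j)%:R) (- (i == k)%:R) (- (i == j)%:R - (i == k)%:R)) => //.
  by rewrite (tgwpa_bryy h) //; apply: wZ; apply: wM.
Qed.

(** Each identity holds in the TGWPA after applying [C], and descends to [R] because [C] is
    injective. *)
Lemma tgwpa_restr_poisson br d : (forall r s, br (C r) (C s) = C (brR r s)) ->
  poisson_derivation br d ->
  (forall u, tgwpa_homog a 0 u -> tgwpa_homog a 0 (d u)) ->
  poisson_derivation brR (tgwpa_restr d).
Proof.
move=> brCC [hd dbr] d0; have E := tgwpa_restrE d0; split; first split.
- move=> c r s; apply: (@tgwpa_C_inj _ _ _ a).
  by rewrite E !tgwpa_CD !tgwpa_CZ (derivationD hd) (derivationZ hd) !E.
- move=> r s; apply: (@tgwpa_C_inj _ _ _ a).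
  by rewrite E tgwpa_CD !tgwpa_CM (derivationM hd) !E.
- move=> r s; apply: (@tgwpa_C_inj _ _ _ a).
  by rewrite E tgwpa_CD -!brCC dbr !E.
Qed.

End Bracket.

(** * The twisted parameters, and the twist evaluated and constructed *)

Section PoissonTwist.
Variables (K : fieldType) (n : nat) (R : comAlgType K).
Variables (brR : R -> R -> R) (D : 'I_n -> R -> R) (a : 'I_n -> R).
Variables (mu gamma : 'I_n -> 'I_n -> K).
Local Notation A := (tgwpa_alg a).
Local Notation C := (tgwpa_C a).
Local Notation x := (tgwpa_x a).
Local Notation y := (tgwpa_y a).
Variables (brA : A -> A -> A) (q p : 'I_n -> 'I_n -> K).
Variable delta : 'rV[int]_n -> A -> A.
Local Notation del i := (delta (delta_mx 0 i)).
Hypothesis hdatum : tgwpa_datum brR D a mu gamma.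
Hypothesis hA : is_tgwpa_bracket brR D a mu gamma brA.
Hypothesis hdelta : poisson_twisting_system brA (tgwpa_homog a) delta.
Hypothesis hdelta_sum : forall (alpha : 'rV[int]_n) (u : A),
  delta alpha u = \sum_(i < n) del i u *~ alpha 0 i.
Hypothesis hdelta_x : forall k j, del k (x j) = q k j *: x j.
Hypothesis hdelta_y : forall k j, del k (y j) = p k j *: y j.
Hypothesis hdelta_D : forall (k j : 'I_n) r,
  D j (tgwpa_restr (del k) r) = tgwpa_restr (del k) (D j r).

Let eta i j := gamma i j - q j i - p j i.
Let nu i j := mu i j - q i j - p j i.
Let nabla i r := D i r - tgwpa_restr (del i) r.

Lemma tgwpa_twist_restrE i r : C (tgwpa_restr (del i) r) = del i (C r).
Proof. by apply: tgwpa_restrE; apply: (pts_graded hdelta). Qed.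

Lemma tgwpa_twist0 u : delta 0 u = 0.
Proof. by rewrite hdelta_sum big1 // => i _; rewrite mxE mulr0z. Qed.

(** Needed because y_i has degree -e_i, so twisted brackets with y_i involve [delta] at -e_i. *)
Lemma tgwpa_twistN alpha u : delta (- alpha) u = - delta alpha u.
Proof.
by rewrite !hdelta_sum -sumrN; apply: eq_bigr => i _; rewrite mxE mulrNz.
Qed.

(** Leibniz rule on a_i = y_i x_i, a product of two eigenvectors. *)
Lemma tgwpa_twist_a i j : tgwpa_restr (del j) (a i) = (q j i + p j i) *: a i.
Proof.
apply: (@tgwpa_C_inj _ _ _ a).
rewrite tgwpa_twist_restrE tgwpa_CZ -tgwpa_yx.
rewrite (derivationM (pts_der hdelta _).1) hdelta_x hdelta_y.
by rewrite -scalerAl -scalerAr scalerDl addrC.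
Qed.

Lemma tgwpa_twist_restr_poisson i :
  poisson_derivation brR (tgwpa_restr (del i)).
Proof.
apply: (tgwpa_restr_poisson (br := brA) (a := a)).
- exact: (tgwpa_brCC hA).
- exact: (pts_der hdelta).
- by move=> u; apply: (pts_graded hdelta).
Qed.

Lemma tgwpa_twist_datum : tgwpa_datum brR nabla a nu eta.
Proof.
have hR := tgwpa_brR hdatum; split.
- exact: hR.
- move=> i; apply: poisson_derivationB.
  + exact: (tgwpa_D_der hdatum).
  + exact: tgwpa_twist_restr_poisson.
  + exact: poisson_bracketC.
  + exact: pbr_der.
- move=> i j r; rewrite /nabla.
  have dB k : {morph D k : r s / r - s}.
    exact: derivationB (tgwpa_D_der hdatum k).1.
  have rB k : {morph tgwpa_restr (del k) : r s / r - s}.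
    exact: derivationB (tgwpa_twist_restr_poisson k).1.
  rewrite !dB !rB !hdelta_D (tgwpa_D_comm hdatum i).
  have -> : tgwpa_restr (del i) (tgwpa_restr (del j) r) =
      tgwpa_restr (del j) (tgwpa_restr (del i) r).
    apply: (@tgwpa_C_inj _ _ _ a); rewrite !tgwpa_twist_restrE.
    exact: (pts_comm hdelta).
  by ring.
- exact: (tgwpa_a_central hdatum).
- exact: (tgwpa_a_regular hdatum).
- move=> i j ij; rewrite /nabla (tgwpa_Da hdatum ij) tgwpa_twist_a /eta.
  by rewrite -scalerBl opprD addrA.
- move=> i j ij; have := tgwpa_gammamu hdatum ij; rewrite /eta /nu => E.
  (* Isolates the subterm that [E] rewrites; both sides of the original relation are lowered by q_ij
     + q_ji + p_ij + p_ji. *)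
  transitivity (gamma i j + gamma j i - q j i - p j i - q i j - p i j).
    by ring.
  by rewrite E; ring.
Qed.

Lemma poisson_twist_is_tgwpa_bracket tw :
  is_poisson_twist brA (tgwpa_homog a) delta tw ->
  is_tgwpa_bracket brR nabla a nu eta tw.
Proof.
move=> [twP twE]; have hC := tgwpa_homogC a.
have hx := tgwpa_homogx a; have hy := tgwpa_homogy a.
split=> //.
- move=> r s; rewrite (twE 0 0) // !tgwpa_twist0 !mulr0 addr0 subr0.
  exact: (tgwpa_brCC hA).
- move=> r i; rewrite (twE _ _ _ _ (hC r) (hx i)) tgwpa_twist0 mulr0 addr0.
  by rewrite (tgwpa_brCx hA) /nabla tgwpa_CB tgwpa_twist_restrE mulrBl (mulrC (x i)).
- move=> r i; rewrite (twE _ _ _ _ (hC r) (hy i)) tgwpa_twist0 mulr0 addr0.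
  rewrite (tgwpa_brCy hA) /nabla tgwpa_CB tgwpa_twist_restrE tgwpa_twistN.
  by rewrite mulrBl mulrN opprK opprB (mulrC (y i)) addrC.
(* The twist subtracts q_ii y_i x_i + p_ii x_i y_i = (q_ii + p_ii) a_i, which is
   delta_{e_i}(a_i). *)
- move=> i; rewrite (twE _ _ _ _ (hy i) (hx i)) (tgwpa_bryx_diag hA).
  rewrite tgwpa_twistN hdelta_x hdelta_y /nabla tgwpa_CB tgwpa_twist_a tgwpa_CZ.
  rewrite -tgwpa_yx mulrN -!scalerAr (mulrC (x i)) scalerDl opprD.
  by rewrite addrA.
- move=> i j ij; rewrite (twE _ _ _ _ (hy i) (hx j)) (tgwpa_bryx hA ij).
  rewrite tgwpa_twistN hdelta_x hdelta_y mulrN -!scalerAr (mulrC (y i)).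
  by rewrite -!scalerBl.
(* The coefficient gains q_ij - q_ji; in eta_ij - nu_ij the two occurrences of p_ji cancel. *)
- move=> i j ij; rewrite (twE _ _ _ _ (hx i) (hx j)) (tgwpa_brxx hA ij).
  rewrite !hdelta_x -!scalerAr (mulrC (x j)) -scalerDl -scalerBl.
  by congr (_ *: _); rewrite /eta /nu; ring.
(* The coefficient gains p_ji - p_ij; in nu_ji - eta_ij the two occurrences of q_ji cancel. *)
- move=> i j ij; rewrite (twE _ _ _ _ (hy i) (hy j)) (tgwpa_bryy hA ij).
  rewrite !tgwpa_twistN !hdelta_y !mulrN -!scalerAr (mulrC (y j)) opprK.
  rewrite -scalerBl -scalerDl.
  by congr (_ *: _); rewrite /eta /nu; ring.
Qed.

(** The x_k and y_k are common eigenvectors of both derivations; on [R] the weight derivation is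
    zero, and delta_{e_j} preserves [R]. So the commutator kills all generators. *)
Lemma tgwpa_weight_twist_comm i j (u : A) :
  tgwpa_weight i (del j u) = del j (tgwpa_weight i u).
Proof.
have hi := tgwpa_weight_der a i; have hj := (pts_der hdelta (delta_mx 0 j)).1.
apply/eqP; rewrite -subr_eq0; apply/eqP; move: u.
apply: tgwpa_derivation_eq0; first exact: derivation_commutator.
- move=> r; rewrite -tgwpa_twist_restrE !tgwpa_weightC (derivation0 hj).
  by rewrite subrr.
- move=> k; rewrite tgwpa_weightx hdelta_x (derivationZ hi) (derivationZ hj).
  by rewrite tgwpa_weightx hdelta_x !scalerA mulrC subrr.
- move=> k; rewrite tgwpa_weighty hdelta_y (derivationZ hi) (derivationZ hj).
  by rewrite tgwpa_weighty hdelta_y !scalerA mulrC subrr.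
Qed.

(** The twist formula refers to degrees and so covers homogeneous arguments only; weight derivations
    extend it to all elements. *)
Definition tgwpa_twist_bracket (u v : A) : A := brA u v
  + \sum_i (tgwpa_weight i u * del i v - tgwpa_weight i v * del i u).

Lemma tgwpa_twist_bracketP :
  is_poisson_twist brA (tgwpa_homog a) delta tgwpa_twist_bracket.
Proof.
split.
  apply: poisson_bracket_sum_wedge.
  - exact: (tgwpa_br hA).
  - by move=> i; exact: (tgwpa_weight_poisson i hA).
  - by move=> i; exact: (pts_der hdelta).
  - exact: tgwpa_weight_comm.
  - by move=> i j u; exact: (pts_comm hdelta).
  - exact: tgwpa_weight_twist_comm.
(* For u of degree g the i-th weight derivation multiplies u by g_i, so the first sum collapses to u
   delta_g(v); likewise the second for v. *)
move=> g h u v gu hv; rewrite /tgwpa_twist_bracket sumrB addrA.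
rewrite !hdelta_sum !mulr_sumr; congr (_ + _ - _); apply: eq_bigr => i _.
  by rewrite (tgwpa_weight_homog i gu) mulrzAl mulrzAr.
by rewrite (tgwpa_weight_homog i hv) mulrzAl mulrzAr.
Qed.

End PoissonTwist.

Theorem theorem3p3 (K : fieldType) (n : nat) (R : comAlgType K)
    (brR : R -> R -> R) (D : 'I_n -> R -> R) (a : 'I_n -> R)
    (mu gamma : 'I_n -> 'I_n -> K)
    (brA : tgwpa_alg a -> tgwpa_alg a -> tgwpa_alg a)
    (q p : 'I_n -> 'I_n -> K)
    (delta : 'rV[int]_n -> tgwpa_alg a -> tgwpa_alg a)
    (hn : (1 <= n)%N)
    (hdatum : tgwpa_datum brR D a mu gamma)
    (hA : is_tgwpa_bracket brR D a mu gamma brA)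
    (hq : forall k j, q k j != 0)
    (hp : forall k j, p k j != 0)
    (hdelta : poisson_twisting_system brA (tgwpa_homog a) delta)
    (hdelta_sum : forall (alpha : 'rV[int]_n) (u : tgwpa_alg a),
       delta alpha u = \sum_(i < n) delta (delta_mx 0 i) u *~ alpha 0 i)
    (hdelta_x : forall k j : 'I_n,
       delta (delta_mx 0 k) (tgwpa_x a j) = q k j *: tgwpa_x a j)
    (hdelta_y : forall k j : 'I_n,
       delta (delta_mx 0 k) (tgwpa_y a j) = p k j *: tgwpa_y a j)
    (hdelta_a : forall k j : 'I_n,
       delta (delta_mx 0 k) (tgwpa_C a (a j))
         = (q k j + p k j) *: tgwpa_C a (a j))
    (hdelta_D : forall (k j : 'I_n) (r : R),
       D j (tgwpa_restr (delta (delta_mx 0 k)) r)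
         = tgwpa_restr (delta (delta_mx 0 k)) (D j r)) :
  let eta := fun i j : 'I_n => gamma i j - q j i - p j i in
  let nu := fun i j : 'I_n => mu i j - q i j - p j i in
  let nabla := fun (i : 'I_n) (r : R) =>
    D i r - tgwpa_restr (delta (delta_mx 0 i)) r in
  [/\ tgwpa_datum brR nabla a nu eta,
      exists tw, is_poisson_twist brA (tgwpa_homog a) delta tw,
      exists br, is_tgwpa_bracket brR nabla a nu eta br
    & forall tw br : tgwpa_alg a -> tgwpa_alg a -> tgwpa_alg a,
        is_poisson_twist brA (tgwpa_homog a) delta tw ->
        is_tgwpa_bracket brR nabla a nu eta br ->
        poisson_isomorphic tw br].
Proof.
move=> eta nu nabla.
have twP tw : is_poisson_twist brA (tgwpa_homog a) delta tw ->
    is_tgwpa_bracket brR nabla a nu eta tw.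
  exact: (poisson_twist_is_tgwpa_bracket hA hdelta hdelta_sum).
have tw0 := tgwpa_twist_bracketP hA hdelta hdelta_sum hdelta_x hdelta_y.
split; [|by exists (tgwpa_twist_bracket brA delta)| |].
- exact: (tgwpa_twist_datum hdatum hA hdelta).
(* The target bracket exists because the constructed twist itself satisfies the relations with the
   new parameters. *)
- by exists (tgwpa_twist_bracket brA delta); exact: twP.
(* Both brackets live on the same algebra and satisfy the same relations on generators, so they
   coincide. *)
move=> tw br /twP htw hbr; exists (idfun : {lrmorphism _ -> _}).
split; first by exists idfun.
by move=> u v /=; exact: (is_tgwpa_bracket_inj htw hbr).
Qed.
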